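(* Let $0<\alpha\le 1$, let $m$ be a positive integer, and let $\mathcal{R}$ be the operator $\mathcal{R}[\psi(x,t)]=\sum_{p=1}^{M}\sum_{q=0}^{N}c_p(x)\,\psi^p(x,t)\,D_x^q\psi(x,t)+h(x,t)$. Consider the time-fractional equation $D_t^{m\alpha}\psi(x,t)=\mathcal{R}[\psi(x,t)]$ with initial conditions $D_t^{i\alpha}\psi(x,0)=f_i(x)$ for $i=0,1,\dots,m-1$. Let $\phi_0,\phi_1,\phi_2,\dots$ be the coefficients of its Laplace residual power series (LRPS) solution $$\Psi(x,s)=\sum_{n=0}^{m-1}\frac{f_n(x)}{s^{1+n\alpha}}+\sum_{n=m}^{\infty}\frac{\phi_n(x)}{s^{1+n\alpha}},$$ that is, $\phi_i=f_i$ for $0\le i\le m-1$ and the functions $\phi_k$, $k\ge m$, satisfy $$\lim_{s\to\infty}s^{k\alpha+1}\,LRes_k(x,s)=0\qquad (k=m,m+1,\dots),$$ where $LRes_k$ is the $k$-th Laplace residual function of the problem. Then $$\phi_m(x)=\mathcal{R}[f_0(x)]\big|_{t=0},\qquad \phi_{m+1}(x)=D_t^{\alpha}\left(\mathcal{R}\left[f_0(x)+\frac{\phi_1(x)\,t^{\alpha}}{\Gamma(1+\alpha)}\right]\right)\Bigg|_{t=0},$$ and for every $k=m+2,m+3,\dots$ $$\phi_k(x)=D_t^{(k-m)\alpha}\left(\mathcal{R}\left[\sum_{n=0}^{k-m}\frac{\phi_n(x)\,t^{n\alpha}}{\Gamma(1+n\alpha)}\right]\right)\Bigg|_{t=0}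.$$
   Context: Here $x$ ranges over an interval $I$ and $t\ge 0$. For $0<\alpha\le1$, $D_t^{\alpha}$ is the Caputo time-fractional derivative $D_t^{\alpha}\psi=I_t^{1-\alpha}\partial_t\psi$, where $I_t^{\beta}\psi(x,t)=\frac{1}{\Gamma(\beta)}\int_0^t(t-\tau)^{\beta-1}\psi(x,\tau)\,d\tau$ for $\beta>0$ and $I_t^0\psi=\psi$. For a positive integer $j$, $D_t^{j\alpha}=D_t^{\alpha}D_t^{\alpha}\cdots D_t^{\alpha}$ ($j$ times) is the sequential (iterated) derivative, and $D_t^{0}$ is the identity. $D_x^q$ is the ordinary $q$-th derivative in $x$. The notation $|_{t=0}$ means the value at $t=0$, understood as the limit $t\to0^+$. The Laplace transform in $t$ is $\mathcal{L}\{\psi\}(x,s)=\int_0^\infty\psi(x,t)e^{-st}\,dt$, for $s$ larger than the exponential order of $\psi$, with inverse $\mathcal{L}^{-1}$. For $n\ge0$, $\mathcal{L}^{-1}\{s^{-1-n\alpha}\}=t^{n\alpha}/\Gamma(1+n\alpha)$. In $\mathcal{R}$, $M,N$ are integers with $M\ge 1$, $N\ge 0$; $c_p(x)$ are coefficient functions of $x$; $h(x,t)$ is a given nonhomogeneous term. For $k\ge m$ the $k$-th truncated series is $\Psi_k(x,s)=\sum_{n=0}^{m-1}\frac{f_n(x)}{s^{1+n\alpha}}+\sum_{n=m}^{k}\frac{\phi_n(x)}{s^{1+n\alpha}}$, and the $k$-th Laplace residual function is $$LRes_k(x,s)=\Psi_k(x,s)-\sum_{n=0}^{m-1}\frac{f_n(x)}{s^{1+n\alpha}}-\frac{1}{s^{m\alpha}}\mathcal{L}\left\{\mathcal{R}\left[\mathcal{L}^{-1}\{\Psi_k(x,s)\}\right]\right\}=\sum_{n=m}^{k}\frac{\phi_n(x)}{s^{1+n\alpha}}-\frac{1}{s^{m\alpha}}\mathcal{L}\left\{\mathcal{R}\left[\sum_{n=0}^{m-1}\frac{f_n(x)\,t^{n\alpha}}{\Gamma(1+n\alpha)}+\sum_{n=m}^{k}\frac{\phi_n(x)\,t^{n\alpha}}{\Gamma(1+n\alpha)}\right]\right\}.$$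 Standing conventions: the functions $f_i,\phi_n$ are differentiable in $x$ as often as needed for $\mathcal{R}$ to be applied; functions of $t$ to which the Laplace transform is applied (including $h$ and its iterated Caputo derivatives $D_t^{j\alpha}h$) are piecewise continuous on $[0,\infty)$ and of exponential order, the iterated Caputo derivatives that occur exist, and the rules $\lim_{s\to\infty}s\,\mathcal{L}\{g\}(x,s)=g(x,0)$ and $\mathcal{L}\{D_t^{n\alpha}g\}=s^{n\alpha}\mathcal{L}\{g\}-\sum_{k=0}^{n-1}s^{(n-k)\alpha-1}D_t^{k\alpha}g|_{t=0}$ apply to them. *)

(* Defs.v *)
(* MathComp-Analysis, over an arbitrary realType. *)
From HB Require Import structures.
From mathcomp Require Import all_boot all_order all_algebra.
From mathcomp Require Import all_classical all_reals all_analysis.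

Set Implicit Arguments.
Unset Strict Implicit.
Unset Printing Implicit Defensive.

Import Order.TTheory GRing.Theory Num.Theory.
Import numFieldNormedType.Exports.

Local Open Scope classical_set_scope.
Local Open Scope ring_scope.

Section TimeVariable.
Context {R : realType}.
Implicit Types (g : R -> R) (alpha beta s t : R).

Local Notation mu := (@lebesgue_measure R).

Definition Gamma beta : R :=
  \int[mu]_(u in `]0, +oo[) (u `^ (beta - 1) * expR (- u)).

(* The Riemann-Liouville integral I_t^beta; I_t^0 is the identity. *)
Definition frac_int beta g t : R :=
  if beta == 0 then g t
  else (Gamma beta)^-1 * \int[mu]_(tau in `]0, t[) ((t - tau) `^ (beta - 1) * g tau).

(* The Caputo derivative, for 0 < alpha <= 1. Its values at t > 0 depend only on
   the values of g on ]0, +oo[; only those values are ever meaningful. *)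
Definition caputo alpha g : R -> R := frac_int (1 - alpha) (derive1 g).

(* The sequential derivative D_t^(j alpha). *)
Definition caputo_iter alpha j g : R -> R := iter j (caputo alpha) g.

(* g is differentiable at every t > 0 and, unless alpha = 1, the integral that
   defines the Caputo derivative converges absolutely. *)
Definition caputo_exists alpha g : Prop :=
  forall t, 0 < t -> derivable g t 1 /\
    (alpha != 1 -> mu.-integrable `]0, t[
       (fun tau => ((t - tau) `^ (- alpha) * derive1 g tau)%:E)).

(* The value at t = 0, i.e. the limit as t -> 0+. *)
Definition initial_value g : R := lim (g t @[t --> 0^'+]).

Definition laplace g s : R := \int[mu]_(t in `[0, +oo[) (g t * expR (- (s * t))).

(* Piecewise continuity on [0, +oo[: one-sided limits exist everywhere, and each
   bounded interval contains only finitely many discontinuities. *)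
Definition piecewise_continuous g : Prop :=
  [/\ forall t, 0 <= t -> cvg (g u @[u --> t^'+]),
      forall t, 0 < t -> cvg (g u @[u --> t^'-])
    & forall T : R, exists E : seq R, forall t, 0 < t < T -> t \notin E ->
        {for t, continuous g}].

Definition exponential_order g : Prop :=
  exists C a : R, \forall t \near +oo, `|g t| <= C * expR (a * t).

(* lim_(s -> oo) s L{g}(s) = g(0) *)
Definition initial_value_rule g : Prop :=
  s * laplace g s @[s --> +oo] --> initial_value g.

(* L{D_t^(n alpha) g}(s)
     = s^(n alpha) L{g}(s) - \sum_(k < n) s^((n - k) alpha - 1) D_t^(k alpha) g|_(t = 0)
   for all large s. *)
Definition laplace_caputo_rule alpha n g : Prop :=
  \forall s \near +oo,
    laplace (caputo_iter alpha n g) s =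
      s `^ (n%:R * alpha) * laplace g s
      - \sum_(0 <= k < n) s `^ ((n - k)%N%:R * alpha - 1)
                          * initial_value (caputo_iter alpha k g).

(* The standing conventions on a function of t to which the Laplace transform
   and the operators D_t^(j alpha) are applied. *)
Definition laplace_admissible alpha g : Prop :=
  (forall j,
     [/\ caputo_exists alpha (caputo_iter alpha j g),
         piecewise_continuous (caputo_iter alpha j g),
         exponential_order (caputo_iter alpha j g)
       & initial_value_rule (caputo_iter alpha j g)])
  /\ (forall n, laplace_caputo_rule alpha n g).

End TimeVariable.

Section SpaceVariable.
Context {R : realType} (I : interval R).
Implicit Types (f : R -> R) (x : R) (q N : nat).

(* Difference quotients at x, along the h for which x + h stays in I: this is
   derive1 at the interior points of I, and the one-sided derivative at an end
   point of I that belongs to I. *)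
Definition diff_quot f x : set_system R :=
  (fun h => h^-1 *: (f (h + x) - f x)) @ within [set h | h + x \in I] 0^'.

Definition Dx1 f x : R := lim (diff_quot f x).

Definition Dx q f : R -> R := iter q Dx1 f.

(* f is N times differentiable on I. *)
Definition differentiable_upto N f : Prop :=
  forall q x, (q < N)%N -> x \in I -> cvg (diff_quot (Dx q f) x).

End SpaceVariable.

Section ResidualPowerSeries.
Context {R : realType}.
Variables (I : interval R) (alpha : R) (m M N : nat).
Variables (c : nat -> R -> R) (h : R -> R -> R).
Implicit Types (f phi : nat -> R -> R) (psi : R -> R -> R) (x t s : R).

(* R[psi](x,t)
     = \sum_(p = 1..M) \sum_(q = 0..N) c_p(x) psi^p(x,t) D_x^q psi(x,t) + h(x,t) *)
Definition Rop psi x t : R :=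
  (\sum_(1 <= p < M.+1) \sum_(0 <= q < N.+1)
     c p x * psi x t ^+ p * Dx I q (fun y => psi y t) x) + h x t.

(* The truncated series Psi_k (x, s), for k >= m. *)
Definition Psi_trunc f phi k x s : R :=
  \sum_(0 <= n < m) f n x / s `^ (1 + n%:R * alpha)
  + \sum_(m <= n < k.+1) phi n x / s `^ (1 + n%:R * alpha).

(* The inverse Laplace transform of Psi_k, by the rule
   L^-1{s^(-1 - n alpha)} = t^(n alpha) / Gamma(1 + n alpha). *)
Definition psi_trunc f phi k x t : R :=
  \sum_(0 <= n < m) f n x * t `^ (n%:R * alpha) / Gamma (1 + n%:R * alpha)
  + \sum_(m <= n < k.+1) phi n x * t `^ (n%:R * alpha) / Gamma (1 + n%:R * alpha).

(* The k-th Laplace residual function. *)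
Definition LRes f phi k x s : R :=
  Psi_trunc f phi k x s
  - \sum_(0 <= n < m) f n x / s `^ (1 + n%:R * alpha)
  - (s `^ (m%:R * alpha))^-1 * laplace (Rop (psi_trunc f phi k) x) s.

(* phi_0, phi_1, ... are the coefficients of the Laplace residual power series
   solution of D_t^(m alpha) psi = R[psi], D_t^(i alpha) psi(x,0) = f_i(x) (i < m). *)
Definition LRPS_coefficients f phi : Prop :=
  (forall i x, (i < m)%N -> x \in I -> phi i x = f i x) /\
  (forall k x, (m <= k)%N -> x \in I ->
     s `^ (k%:R * alpha + 1) * LRes f phi k x s @[s --> +oo] --> (0 : R)).

End ResidualPowerSeries.

(* Main.v *)
Require Import Defs.
From mathcomp Require Import all_boot all_order all_algebra.
From mathcomp Require Import all_classical all_reals all_analysis.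
From mathcomp Require Import measurable_realfun ring lra.
Import Order.TTheory GRing.Theory Num.Theory.
Import numFieldNormedType.Exports.
Set Implicit Arguments.
Unset Strict Implicit.
Unset Printing Implicit Defensive.
Local Open Scope classical_set_scope.
Local Open Scope ring_scope.

(** Fix a point x of I. Along the truncated series with K terms, the spatial
    derivatives act on the coefficients alone, so the nonlinear part of the
    operator is a polynomial Q_K in t^alpha ([Rop_polyE]), and the coefficient
    of t^(j alpha) in it is the same for all K > j, since it involves only
    phi_0, ..., phi_j ([coef_Rop_poly]). Let b_j be that coefficient times
    Gamma(1 + j alpha), and h_j the value at 0+ of D^(j alpha) h. Both the
    hypothesis and the conclusion are ways of reading off b_j + h_j.

    - Hypothesis. The Laplace transform sends t^(i alpha)/Gamma(1 + i alpha) to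
      s^(-1 - i alpha). Inserting the transform rule for D^(j alpha) h, the
      residual LRes_(m + j) multiplied by s^((m + j) alpha + 1) becomes
        sum_(i < j) (phi_(m+i) - b_i - h_i) s^((j - i) alpha)
          + phi_(m+j) - b_j - s L(D^(j alpha) h)(s)
          + negative powers of s
      ([laplace_residual], [residual_split]). By strong induction on j the
      growing powers vanish, and since s L(D^(j alpha) h)(s) tends to h_j, the
      vanishing of the limit says phi_(m+j) = b_j + h_j
      ([LRPS_coefficientE]).

    - Conclusion. On t > 0 the Caputo derivative sends
      t^((i+1) alpha)/Gamma(1 + (i+1) alpha) to t^(i alpha)/Gamma(1 + i alpha)
      and constants to 0. Hence D^(j alpha) shifts the coefficients by j, and
      as t -> 0+ only b_j + h_j is left ([caputo_iter_fracsumD],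
      [cvg_fracsum], [cvg_caputo_iter_Rop]).

    Two analytic inputs need work. The Caputo derivative of a power is the Beta
    integral with exponents i alpha and 1 - alpha, so Euler's identity
    B(a, b) = Gamma(a) Gamma(b) / Gamma(a + b) is needed for real exponents;
    it comes from the Tonelli theorem ([EGamma_mul]). Splitting the Laplace
    transform of a sum requires h to be Laplace integrable, which follows from
    its continuity on t > 0, its limit at 0+ and its exponential order
    ([laplace_integrable_exp]). *)

(** * Affine change of variables *)

Section AffineChange.
Context {R : realType}.
Variables a b : R.
Hypothesis a0 : 0 < a.
Local Notation mu := (@lebesgue_measure R).

Let affine (x : measurableTypeR R) : measurableTypeR R := a * x + b.

Let measurable_affine : measurable_fun setT affine.
Proof. by apply: measurable_funD => //; exact: measurable_funM. Qed.

Let nu := pushforward (mscale (NngNum (ltW a0)) mu) affine.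

Let lebesgue_measure_affine (A : set (measurableTypeR R)) : measurable A ->
  nu A = mu A.
Proof.
move=> mA; apply/esym/lebesgue_measure_unique => //= _ [[u v]] _ <-.
rewrite /nu /pushforward /mscale/=.
have -> : affine @^-1` `]u, v] = `](u - b) / a, (v - b) / a]%classic.
  apply/seteqP; split => x /=; rewrite !in_itv/= /affine;
  by rewrite ltr_pdivrMr// ler_pdivlMr// (mulrC x); lra.
rewrite !lebesgue_measure_itv/= !lte_fin ltr_pM2r ?invr_gt0// ltrD2r.
case: ifPn => _; last by rewrite mule0.
by rewrite -!EFinB -EFinM; congr (_%:E); field; rewrite gt_eqF.
Qed.

(** The right-hand side integrates against a times the image of Lebesgue measure
    under the affine map; that measure agrees with Lebesgue measure on
    half-open intervals, hence everywhere. *)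
Lemma ge0_integral_affine (f : R -> \bar R) : measurable_fun setT f ->
  (forall x, 0 <= f x)%E ->
  (\int[mu]_x f x = a%:E * \int[mu]_x f (a * x + b)%R)%E.
Proof.
move=> mf f0; transitivity (\int[nu]_x f x)%E.
  by apply: eq_measure_integral => /= A mA _; exact/esym/lebesgue_measure_affine.
rewrite /nu ge0_integral_pushforward// preimage_setT.
rewrite ge0_integral_mscale//; [exact: measurableT_comp | move=> x _; exact: f0].
Qed.

End AffineChange.

(** * The Euler integrals and their product formula *)

Section GammaBeta.
Context {R : realType}.
Implicit Types (a b c s w x : R).
Local Notation mu := (@lebesgue_measure R).

(** The function x^(c-1) extended by 0 to x <= 0, so that the integrals below
    range over the whole line and translations need no change of domain. *)
Definition pospow c x : R := if 0 < x then x `^ (c - 1) else 0.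

Lemma pospow_ge0 c x : 0 <= pospow c x.
Proof. by rewrite /pospow; case: ifP => // _; exact: powR_ge0. Qed.

Lemma measurable_pospow c : measurable_fun setT (pospow c).
Proof.
by apply: measurable_fun_ifT => //; exact: measurable_fun_ltr.
Qed.

Lemma pospowM c w x : 0 < w -> pospow c (w * x) = w `^ (c - 1) * pospow c x.
Proof.
move=> w0; rewrite /pospow pmulr_rgt0//; case: ifPn => x0; last by rewrite mulr0.
by rewrite powRM// ltW.
Qed.

(** Extended-real versions of the Euler integrals: the Tonelli theorem then
    applies before convergence is known. *)
Definition EGamma c : \bar R := (\int[mu]_x (pospow c x * expR (- x))%:E)%E.

Definition EBeta a b : \bar R :=
  (\int[mu]_x (pospow a x * pospow b (1 - x))%:E)%E.

Lemma measurable_pospow_expR c s :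
  measurable_fun setT (fun x => pospow c x * expR (- (s * x))).
Proof.
apply: measurable_funM; first exact: measurable_pospow.
by apply: measurableT_comp => //; apply: measurableT_comp => //; exact: measurable_funM.
Qed.

Lemma measurable_pospow_conv a b w :
  measurable_fun setT (fun x => pospow a x * pospow b (w - x)).
Proof.
apply: measurable_funM; first exact: measurable_pospow.
apply: measurableT_comp; first exact: measurable_pospow.
exact: measurable_funB.
Qed.

(** By the scaling x := w x; for w <= 0 the two supports are disjoint. *)
Lemma integral_pospow_conv a b w :
  (\int[mu]_x (pospow a x * pospow b (w - x))%:E =
   (pospow (a + b) w)%:E * EBeta a b)%E.
Proof.
have [w0|w0] := ltP 0 w; last first.
  rewrite [X in (X%:E * _)%E]/pospow ltNge w0/= mul0e integral0_eq// => x _.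
  rewrite /pospow; case: ifPn => x0; last by rewrite mul0r.
  by rewrite subr_gt0 [x < w]ltNge (ltW (le_lt_trans w0 x0)) mulr0.
rewrite (@ge0_integral_affine _ w 0 w0); first last.
- by move=> x; rewrite lee_fin mulr_ge0 ?pospow_ge0.
- by apply/measurable_EFinP; exact: measurable_pospow_conv.
under eq_integral => x _.
  rewrite addr0 (_ : w - w * x = w * (1 - x)); last by ring.
  rewrite !pospowM// mulrACA EFinM.
  over.
rewrite ge0_integralZl//; first last.
- by rewrite lee_fin mulr_ge0 ?powR_ge0.
- by move=> x _; rewrite lee_fin mulr_ge0 ?pospow_ge0.
- by apply/measurable_EFinP; exact: measurable_pospow_conv.
rewrite muleA -EFinM /pospow w0; congr (_%:E * _)%E.
rewrite -{1}(powRr1 (ltW w0)) -!powRD ?(gt_eqF w0) ?implybT//.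
by congr (_ `^ _); ring.
Qed.

Lemma integral_pospow_expR c s : 0 < s ->
  (\int[mu]_x (pospow c x * expR (- (s * x)))%:E = (s `^ (- c))%:E * EGamma c)%E.
Proof.
move=> s0; rewrite (@ge0_integral_affine _ s^-1 0) ?invr_gt0//; first last.
- by move=> x; rewrite lee_fin mulr_ge0 ?expR_ge0 ?pospow_ge0.
- by apply/measurable_EFinP; exact: measurable_pospow_expR.
under eq_integral => x _.
  rewrite addr0 mulrA divff ?gt_eqF// mul1r pospowM ?invr_gt0// -mulrA EFinM.
  over.
rewrite ge0_integralZl//; first last.
- by rewrite lee_fin powR_ge0.
- by move=> x _; rewrite lee_fin mulr_ge0 ?expR_ge0 ?pospow_ge0.
- apply/measurable_EFinP; under eq_fun do rewrite -[X in - X]mul1r.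
  exact: measurable_pospow_expR.
rewrite muleA -EFinM; congr (_%:E * _)%E.
rewrite -powR_inv1 ?ltW// -powRrM -powRD ?(gt_eqF s0) ?implybT//.
by congr (_ `^ _); ring.
Qed.

(** Write the product as a double integral in x and y, put y = w - x so that
    the exponentials combine into exp(-w), and exchange the integrals: the
    inner integral in x is the convolution [integral_pospow_conv]. *)
Lemma EGamma_mul a b : (EGamma a * EGamma b = EBeta a b * EGamma (a + b))%E.
Proof.
have m1 c : measurable_fun setT (fun x => pospow c x * expR (- x)).
  under eq_fun do rewrite -[X in - X]mul1r.
  exact: measurable_pospow_expR.
have p1 c x : (0 <= (pospow c x * expR (- x))%:E)%E.
  by rewrite lee_fin mulr_ge0 ?expR_ge0 ?pospow_ge0.
have EG0 c : (0 <= EGamma c)%E by apply: integral_ge0 => x _.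
have EB0 : (0 <= EBeta a b)%E.
  by apply: integral_ge0 => x _; rewrite lee_fin mulr_ge0 ?pospow_ge0.
rewrite {1}/EGamma -ge0_integralZr//; last by apply/measurable_EFinP; exact: m1.
transitivity (\int[mu]_x \int[mu]_w
   (pospow a x * pospow b (w - x) * expR (- w))%:E)%E.
  apply: eq_integral => x _.
  rewrite /EGamma -ge0_integralZl//; last by apply/measurable_EFinP; exact: m1.
  rewrite [RHS](@ge0_integral_affine _ 1 x)//; first last.
  - by move=> y; rewrite lee_fin !mulr_ge0 ?expR_ge0 ?pospow_ge0.
  - apply/measurable_EFinP; apply: measurable_funM; last first.
      by do 2 apply: measurableT_comp => //.
    apply: measurable_funM => //.
    by apply: measurableT_comp; [exact: measurable_pospow|exact: measurable_funB].
  rewrite mul1e; apply: eq_integral => y _.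
  rewrite mul1r addrK -EFinM; congr _%:E.
  by rewrite mulrACA -expRD; congr (_ * expR _); ring.
transitivity (\int[mu]_w \int[mu]_x
   (pospow a x * pospow b (w - x) * expR (- w))%:E)%E.
  apply: (@fubini_tonelli _ _ _ _ _ mu mu (fun p : R * R =>
     (pospow a p.1 * pospow b (p.2 - p.1) * expR (- p.2))%:E)); last first.
    by move=> p; rewrite lee_fin !mulr_ge0 ?expR_ge0 ?pospow_ge0.
  apply/measurable_EFinP; apply: measurable_funM; last first.
    by do 2 apply: measurableT_comp => //.
  apply: measurable_funM.
    by apply: measurableT_comp; first exact: measurable_pospow.
  by apply: measurableT_comp; [exact: measurable_pospow|exact: measurable_funB].
transitivity (\int[mu]_w (EBeta a b * (pospow (a + b) w * expR (- w))%:E))%E.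
  apply: eq_integral => w _ /=.
  under eq_integral do rewrite EFinM.
  rewrite ge0_integralZr ?lee_fin ?expR_ge0//; first last.
  - by move=> x _; rewrite lee_fin mulr_ge0 ?pospow_ge0.
  - by apply/measurable_EFinP; exact: measurable_pospow_conv.
  by rewrite integral_pospow_conv EFinM (muleC (_%:E) (EBeta _ _)) muleA.
by rewrite ge0_integralZl//; by apply/measurable_EFinP; exact: m1.
Qed.

End GammaBeta.

(** * Special values *)

Section GammaValues.
Context {R : realType}.
Implicit Types (a b c s w x : R).
Local Notation mu := (@lebesgue_measure R).

Lemma EGammaE c :
  EGamma c = (\int[mu]_(x in `]0%R, +oo[) (x `^ (c - 1) * expR (- x))%:E)%E.
Proof.
rewrite [RHS]integral_mkcond; apply: eq_integral => x _.
rewrite patchE mem_setE in_itv/= andbT /pospow.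
by case: ifPn => // _; rewrite mul0r.
Qed.

Lemma EGamma_1 : EGamma (1 : R) = 1%E.
Proof.
rewrite EGammaE -(integral_exponential_pdf (@ltr01 R)).
rewrite (integral_itv_obnd_cbnd); last first.
  apply/measurable_EFinP; apply: measurable_funM => //.
    by apply: measurable_funTS; exact: measurable_powR.
  by apply: measurable_funTS; apply: measurableT_comp => //; exact: measurableT_comp.
rewrite integral_mkcond; apply: eq_integral => x _.
rewrite /exponential_pdf !patchE; case: ifPn => // _.
by rewrite subrr powRr0 mulN1r mul1r.
Qed.

(** The lower end stays positive because x^(c-1) is unbounded at 0 when
    c < 1. *)
Lemma continuous_FTC2_powR c (d : R) : 0 < c -> 0 < d < 1 ->
  (\int[mu]_(x in `[d, 1%R]) (x `^ (c - 1))%:E = (c^-1 - c^-1 * d `^ c)%:E)%E.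
Proof.
move=> c0 /andP[d0 d1].
have dF x : 0 < x -> is_derive x 1 (c^-1 \*: (@powR R)^~ c) (x `^ (c - 1)).
  move=> x0.
  have dp := is_deriveZ c^-1 (is_derive1_powR c x0).
  apply: (is_derive_eq dp).
  by rewrite /GRing.scale/= mulrA mulVf ?mul1r// gt_eqF.
rewrite (@continuous_FTC2 _ _ (c^-1 \*: (@powR R)^~ c))//.
- by rewrite /= powR1 /= -[_ *: 1]/(_ * 1) mulr1.
- apply: derivable_within_continuous => x; rewrite in_itv/= => /andP[dx _].
  by apply: derivable_powR; rewrite in_itv/= andbT (lt_le_trans d0).
- have cF x : 0 < x -> {for x, continuous (c^-1 \*: (@powR R)^~ c)}.
    move=> x0; apply/differentiable_continuous/derivable1_diffP.
    by have [] := dF _ x0.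
  split.
  + move=> x; rewrite in_itv/= => /andP[dx _].
    by have [] := dF _ (lt_trans d0 dx).
  + exact/cvg_at_right_filter/cF.
  + exact/cvg_at_left_filter/cF.
- move=> x; rewrite in_itv/= => /andP[dx _]; rewrite derive1E.
  by have [_ ->] := dF _ (lt_trans d0 dx).
Qed.

(** The increasing limit of [continuous_FTC2_powR] along the lower ends
    d = 1/(n+2). With [EGamma_mul] this value yields the functional equation of
    Gamma without integrating by parts on the half line. *)
Lemma EBeta_1r c : 0 < c -> EBeta c 1 = (c^-1)%:E.
Proof.
move=> c0.
have -> : EBeta c 1 = (\int[mu]_(x in `]0%R, 1%R[) (x `^ (c - 1))%:E)%E.
  rewrite [RHS]integral_mkcond; apply: eq_integral => x _.
  rewrite patchE mem_setE in_itv/= /pospow subr_gt0 subrr powRr0.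
  case: ifPn => x0; last by rewrite mul0r.
  by case: ifPn => x1; rewrite ?mulr1// mulr0.
have mp D : measurable_fun D (fun x : R => (x `^ (c - 1))%:E).
  by apply/measurable_EFinP; apply: measurable_funTS; exact: measurable_powR.
rewrite integral_itv_bndo_bndc//.
pose F n : set R := `[harmonic n.+1, 1%R]%classic.
have -> : `]0%R, 1%R]%classic = \bigcup_n F n.
  apply/seteqP; split => [x /=|x [n _]]; rewrite /F/= !in_itv/=; last first.
    by move=> /andP[nx ->]; rewrite andbT (lt_le_trans _ nx)// harmonic_gt0.
  move=> /andP[x0 x1].
  have [n _ /(_ n (leqnn n)) nx] : \forall n \near \oo, harmonic n < x.
    by apply: (cvgr_lt _ (@cvg_harmonic R)).
  exists n => //=; rewrite in_itv/= x1 andbT (le_trans _ (ltW nx))//.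
  by rewrite /harmonic lef_pV2 ?posrE// ler_nat.
have : ((\int[mu]_(x in F n) (x `^ (c - 1))%:E)%E @[n --> \oo] -->
        (\int[mu]_(x in \bigcup_n F n) (x `^ (c - 1))%:E)%E).
  apply: ge0_nondecreasing_set_cvg_integral => //.
  - move=> n m nm; apply/subsetPset => x; rewrite /F/= !in_itv/= => /andP[nx ->].
    by rewrite andbT (le_trans _ nx)// /harmonic lef_pV2 ?posrE// ler_nat.
  - by move=> n; exact: measurable_itv.
  - by move=> n; exact: mp.
  - by move=> n x _; rewrite lee_fin powR_ge0.
move=> cF; rewrite -(cvg_lim _ cF)//; apply/cvg_lim => //.
under eq_fun => n do rewrite continuous_FTC2_powR ?harmonic_gt0 ?invf_lt1 ?ltr1n//.
apply: cvg_EFin; first exact: nearW.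
rewrite -[X in _ --> X]subr0; apply: cvgB; first exact: cvg_cst.
rewrite -(mulr0 c^-1); apply: cvgM; first exact: cvg_cst.
apply: ((cvg_at_rightP _ 0 _).1 (powR_cvg0 c0) (fun n => harmonic n.+1)).
split => [n|]; first exact: harmonic_gt0.
by rewrite (@cvg_shiftS _ (@harmonic R)); exact: cvg_harmonic.
Qed.

End GammaValues.

(** * The real Gamma function and the Abel integral *)

Section RealGamma.
Context {R : realType}.
Implicit Types (a b c s t x : R).
Local Notation mu := (@lebesgue_measure R).

Lemma EGamma_ge0 c : (0 <= EGamma c)%E.
Proof.
by apply: integral_ge0 => x _; rewrite lee_fin mulr_ge0 ?expR_ge0 ?pospow_ge0.
Qed.

(** [EGamma_mul] with b = 1. *)
Lemma EGammaS c : 0 < c -> (EGamma (c + 1) = c%:E * EGamma c)%E.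
Proof.
move=> c0; have := EGamma_mul c 1.
rewrite EGamma_1 mule1 EBeta_1r// => ->.
by rewrite muleA -EFinM mulfV ?gt_eqF// mul1e.
Qed.

Lemma EGamma_nat_fin n : EGamma (n.+1%:R : R) \is a fin_num.
Proof.
elim: n => [|n IH]; first by rewrite EGamma_1.
by rewrite -natr1 EGammaS// fin_numM.
Qed.

(** The functional equation reduces the claim to c + 1 > 1, where
    x^c <= 1 + x^(n+1) for any n+1 >= c bounds the integrand by two Gamma
    integrands at positive integers. *)
Lemma EGamma_fin c : 0 < c -> EGamma c \is a fin_num.
Proof.
move=> c0; suff : EGamma (c + 1) \is a fin_num.
  rewrite EGammaS// => cG; rewrite -[EGamma c]mul1e -(mulVf (lt0r_neq0 c0)) EFinM.
  by rewrite -muleA fin_numM.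
have m c' : measurable_fun setT (fun x => (pospow c' x * expR (- x))%:E).
  apply/measurable_EFinP; under eq_fun do rewrite -[X in - X]mul1r.
  exact: measurable_pospow_expR.
have p c' x : (0 <= (pospow c' x * expR (- x))%:E)%E.
  by rewrite lee_fin mulr_ge0 ?expR_ge0 ?pospow_ge0.
pose n := Num.truncn c.
have cn : c <= n.+1%:R by rewrite ltW// truncnS_gt.
rewrite ge0_fin_numE ?EGamma_ge0//.
apply: (@le_lt_trans _ _ (EGamma (1%:R : R) + EGamma (n.+2%:R : R))%E); last first.
  by rewrite lte_add_pinfty// -ge0_fin_numE ?EGamma_ge0// EGamma_nat_fin.
rewrite /EGamma -ge0_integralD//; last 2 first.
- exact: m.
- exact: m.
apply: ge0_le_integral => //.
- exact: m.
- by apply: emeasurable_funD; exact: m.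
move=> x _; rewrite -EFinD lee_fin -mulrDl ler_wpM2r ?expR_ge0//.
rewrite /pospow; case: ifPn => [x0|]; last by rewrite addr0.
rewrite subrr powRr0 addrK -natr1 addrK.
have [x1|x1] := leP x 1.
  rewrite (@le_trans _ _ 1)// ?lerDl ?powR_ge0//.
  by rewrite -(powRr0 x) ger_powR ?x0// ltW.
by rewrite (le_trans (ler_powR (ltW x1) cn))// lerDr.
Qed.

(** After the same reduction to c + 1, the integrand is at least exp(-2) on
    the interval [1, 2]. *)
Lemma EGamma_gt0 c : 0 < c -> (0 < EGamma c)%E.
Proof.
move=> c0; suff : (0 < EGamma (c + 1))%E by rewrite EGammaS// pmule_rgt0.
have mD (D : set R) :
    measurable_fun D (fun x => (x `^ (c + 1 - 1) * expR (- x))%:E).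
  apply/measurable_EFinP; apply: measurable_funTS.
  apply: measurable_funM; first exact: measurable_powR.
  by apply: measurableT_comp => //; exact: measurableT_comp.
apply: (@lt_le_trans _ _ (\int[mu]_(x in `[1%R, 2%R]) (expR (-2))%:E)%E).
  rewrite integral_cst//= lebesgue_measure_itv/= lte_fin ltr1n -EFinB -EFinM.
  by rewrite lte_fin mulr_gt0 ?expR_gt0// subr_gt0 ltr1n.
rewrite EGammaE.
apply: (@le_trans _ _ (\int[mu]_(x in `[1%R, 2%R]) (x `^ (c + 1 - 1) * expR (- x))%:E)%E).
  apply: ge0_le_integral => //.
  - exact: mD.
  move=> x; rewrite /= in_itv/= => /andP[x1 x2].
  rewrite lee_fin addrK -[leLHS]mul1r ler_pM ?expR_ge0//.
    by rewrite -[leLHS](powRr0 x) ler_powR// ltW.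
  by rewrite ler_expR lerN2.
apply: ge0_subset_integral => //.
- exact: mD.
- by move=> x _; rewrite lee_fin mulr_ge0 ?expR_ge0 ?powR_ge0.
- by move=> x; rewrite /= !in_itv/= => /andP[x1 _]; rewrite andbT (lt_le_trans _ x1).
Qed.

Lemma GammaE c : 0 < c -> (Gamma c)%:E = EGamma c.
Proof. by move=> c0; rewrite EGammaE fineK// -EGammaE EGamma_fin. Qed.

Lemma Gamma_gt0 c : 0 < c -> 0 < Gamma c.
Proof. by move=> c0; rewrite -lte_fin GammaE// EGamma_gt0. Qed.

Lemma Gamma1 : Gamma (1 : R) = 1.
Proof. by apply: EFin_inj; rewrite GammaE// EGamma_1. Qed.

Lemma GammaS c : 0 < c -> Gamma (1 + c) = c * Gamma c.
Proof.
move=> c0; apply: EFin_inj.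
by rewrite GammaE ?addr_gt0// addrC EGammaS// EFinM GammaE.
Qed.

Lemma EBetaE a b : 0 < a -> 0 < b ->
  EBeta a b = (Gamma a * Gamma b / Gamma (a + b))%:E.
Proof.
move=> a0 b0; have ab0 := addr_gt0 a0 b0; have := EGamma_mul a b.
rewrite -!GammaE// -EFinM => /(congr1 (fun z => z * ((Gamma (a + b))^-1)%:E)%E).
rewrite -!EFinM -muleA -EFinM mulfV ?mule1 => [<-//|].
by rewrite gt_eqF// Gamma_gt0.
Qed.

(** The Abel integral behind every fractional integral of a power. *)
Lemma integral_abel a b t : 0 < a -> 0 < b -> 0 < t ->
  (\int[mu]_(x in `]0%R, t[) ((t - x) `^ (b - 1) * x `^ (a - 1))%:E =
   (Gamma a * Gamma b / Gamma (a + b) * t `^ (a + b - 1))%:E)%E.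
Proof.
move=> a0 b0 t0.
transitivity (\int[mu]_x (pospow a x * pospow b (t - x))%:E)%E.
  rewrite integral_mkcond; apply: eq_integral => x _.
  rewrite patchE mem_setE in_itv/= /pospow subr_gt0.
  by case: (0 < x); case: (x < t); rewrite /= ?mul0r ?mulr0// mulrC.
by rewrite integral_pospow_conv EBetaE// /pospow t0 -EFinM mulrC.
Qed.

Lemma integral_powR_expR c s : 0 <= c -> 0 < s ->
  (\int[mu]_(x in `[0%R, +oo[) (x `^ c * expR (- (s * x)))%:E =
   (Gamma (1 + c) / s `^ (1 + c))%:E)%E.
Proof.
move=> c0 s0; have c1 : 0 < 1 + c by rewrite ltr_wpDr.
rewrite -integral_itv_obnd_cbnd; last first.
  apply/measurable_EFinP; apply: measurable_funM.
    by apply: measurable_funTS; exact: measurable_powR.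
  apply: measurable_funTS; apply: measurableT_comp => //.
  by apply: measurableT_comp => //; exact: measurable_funM.
transitivity (\int[mu]_x (pospow (1 + c) x * expR (- (s * x)))%:E)%E.
  rewrite integral_mkcond; apply: eq_integral => x _.
  rewrite patchE mem_setE in_itv/= andbT /pospow addrC addKr.
  by case: ifPn => // _; rewrite mul0r.
by rewrite integral_pospow_expR// -GammaE// -EFinM powRN mulrC.
Qed.

End RealGamma.

(** * Caputo derivatives of fractional powers *)

Lemma cvg_sum_ord {R : realType} {T : Type} {F : set_system T} {FF : Filter F}
    n (u : 'I_n -> T -> R) (l : 'I_n -> R) :
  (forall i, u i x @[x --> F] --> l i) ->
  \sum_(i < n) u i x @[x --> F] --> \sum_(i < n) l i.
Proof.
elim: n u l => [|n IH] u l ul.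
  by under eq_fun do rewrite big_ord0; rewrite big_ord0; exact: cvg_cst.
under eq_fun do rewrite big_ord_recl; rewrite big_ord_recl.
by apply: cvgD => //; exact: IH.
Qed.

Section CaputoCalculus.
Context {R : realType}.
Variable alpha : R.
Hypothesis halpha : 0 < alpha <= 1.
Implicit Types (g h : R -> R) (b : nat -> R) (i j n : nat) (t : R).
Local Notation mu := (@lebesgue_measure R).

Let alpha0 : 0 < alpha. Proof. by case/andP: halpha. Qed.

Let caputoE g t : alpha != 1 -> caputo alpha g t =
  (Gamma (1 - alpha))^-1 *
  \int[mu]_(x in `]0, t[) ((t - x) `^ (- alpha) * derive1 g x).
Proof.
move=> a1; rewrite /caputo /frac_int subr_eq0 eq_sym (negbTE a1).
by rewrite addrAC subrr add0r.
Qed.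

Let caputo1E g t : alpha = 1 -> caputo alpha g t = derive1 g t.
Proof. by move=> a1; rewrite /caputo /frac_int a1 subrr eqxx. Qed.

Lemma eq_derive1_pos g1 g2 : (forall t, 0 < t -> g1 t = g2 t) ->
  forall t, 0 < t -> derive1 g1 t = derive1 g2 t.
Proof.
move=> e t t0; rewrite !derive1E; apply: near_eq_derive.
by near=> x; apply: e; near: x; exact: lt_nbhsr.
Unshelve. all: by end_near. Qed.

(** At t > 0 the Caputo derivative sees only the values on t > 0, so the power
    rule below, which holds there, can be iterated. *)
Lemma eq_caputo_pos g1 g2 : (forall t, 0 < t -> g1 t = g2 t) ->
  forall t, 0 < t -> caputo alpha g1 t = caputo alpha g2 t.
Proof.
move=> e t t0; have [a1|a1] := eqVneq alpha 1.
  by rewrite !caputo1E//; exact: eq_derive1_pos.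
rewrite !(caputoE _ _ a1).
have -> // : \int[mu]_(x in `]0, t[) ((t - x) `^ (- alpha) * derive1 g1 x) =
             \int[mu]_(x in `]0, t[) ((t - x) `^ (- alpha) * derive1 g2 x).
apply: eq_Rintegral => x; rewrite inE/= in_itv/= => /andP[x0 _].
by rewrite (eq_derive1_pos e).
Qed.

Lemma caputo_existsD g1 g2 : caputo_exists alpha g1 -> caputo_exists alpha g2 ->
  caputo_exists alpha (fun t => g1 t + g2 t).
Proof.
move=> e1 e2 t t0; split; first by apply: derivableD; [case: (e1 t t0)|case: (e2 t t0)].
move=> a1; have := integrableD _ ((e1 t t0).2 a1) ((e2 t t0).2 a1).
move=> /(_ (measurable_itv _)); apply: eq_integrable => // x.
rewrite inE/= in_itv/= => /andP[x0 _].
rewrite -EFinD -mulrDr !derive1E deriveD//; [exact: (e1 x x0).1|exact: (e2 x x0).1].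
Qed.

Lemma caputoD g1 g2 : caputo_exists alpha g1 -> caputo_exists alpha g2 ->
  forall t, 0 < t ->
  caputo alpha (fun t => g1 t + g2 t) t = caputo alpha g1 t + caputo alpha g2 t.
Proof.
move=> e1 e2 t t0.
have dD x : 0 < x ->
    derive1 (fun t => g1 t + g2 t) x = derive1 g1 x + derive1 g2 x.
  move=> x0; rewrite !derive1E deriveD//; [exact: (e1 x x0).1|exact: (e2 x x0).1].
have [a1|a1] := eqVneq alpha 1; first by rewrite !caputo1E// dD.
rewrite !(caputoE _ _ a1) -mulrDr; congr (_ * _).
rewrite -RintegralD//; [|exact: (e1 t t0).2 a1|exact: (e2 t t0).2 a1].
apply: eq_Rintegral => x; rewrite inE/= in_itv/= => /andP[x0 _].
by rewrite dD// mulrDr.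
Qed.

Lemma caputo_existsZ k g : caputo_exists alpha g ->
  caputo_exists alpha (fun t => k * g t).
Proof.
move=> e t t0; split; first by apply: derivableZ; case: (e t t0).
move=> a1; have := integrableZl _ k ((e t t0).2 a1).
move=> /(_ (measurable_itv _)); apply: eq_integrable => // x.
rewrite inE/= in_itv/= => /andP[x0 _].
rewrite -EFinM !derive1E deriveZ; last exact: (e x x0).1.
by rewrite /GRing.scale/= mulrCA.
Qed.

Lemma caputoZ k g : caputo_exists alpha g ->
  forall t, 0 < t -> caputo alpha (fun t => k * g t) t = k * caputo alpha g t.
Proof.
move=> e t t0.
have dZ x : 0 < x -> derive1 (fun t => k * g t) x = k * derive1 g x.
  by move=> x0; rewrite !derive1E deriveZ//; exact: (e x x0).1.
have [a1|a1] := eqVneq alpha 1; first by rewrite !caputo1E// dZ.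
rewrite !(caputoE _ _ a1) mulrCA; congr (_ * _).
rewrite -RintegralZl//; last exact: (e t t0).2 a1.
apply: eq_Rintegral => x.
by rewrite inE/= in_itv/= => /andP[x0 _]; rewrite dZ// mulrCA.
Qed.

Lemma caputo_cst k : caputo_exists alpha (fun=> k) /\
  forall t, caputo alpha (fun=> k) t = 0.
Proof.
have d0 x : derive1 ((fun=> k) : R -> R) x = 0 by exact: derive1_cst.
split => [t t0|t].
  split; first exact: derivable_cst.
  move=> _; apply: (eq_integrable _ (cst 0%E)) => //; last exact: integrable0.
  by move=> x _; rewrite d0 mulr0.
have [a1|a1] := eqVneq alpha 1; first by rewrite caputo1E.
rewrite (caputoE _ _ a1); under eq_Rintegral do rewrite d0 mulr0.
by rewrite Rintegral_cst// mul0r mulr0.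
Qed.

(** Divided by Gamma, the fractional powers become the chain on which the Caputo
    derivative acts as a shift and whose Laplace transforms are pure powers of
    s. *)
Definition fracmono i t : R := t `^ (i%:R * alpha) / Gamma (1 + i%:R * alpha).

Lemma fracmono0 : fracmono 0 = fun=> 1.
Proof. by apply/funext => t; rewrite /fracmono mul0r powRr0 addr0 Gamma1 divr1. Qed.

Let derive_fracmonoS i t : 0 < t -> is_derive t 1 (fracmono i.+1)
  (t `^ (i.+1%:R * alpha - 1) / Gamma (i.+1%:R * alpha)).
Proof.
move=> t0; have c0 : 0 < i.+1%:R * alpha by rewrite mulr_gt0.
have -> : fracmono i.+1 =
    (Gamma (1 + i.+1%:R * alpha))^-1 \*: (@powR R)^~ (i.+1%:R * alpha).
  by apply/funext => x; rewrite /fracmono mulrC.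
apply: (is_derive_eq (is_deriveZ _ (is_derive1_powR _ t0))).
by rewrite /GRing.scale/= GammaS// invfM mulrACA mulVf ?gt_eqF// mul1r mulrC//.
Qed.

(** For alpha < 1 this is [integral_abel] with a = (i+1) alpha and
    b = 1 - alpha: the factor Gamma(1 - alpha) cancels against the normalisation
    of the fractional integral. *)
Lemma caputo_fracmonoS i : caputo_exists alpha (fracmono i.+1) /\
  forall t, 0 < t -> caputo alpha (fracmono i.+1) t = fracmono i t.
Proof.
pose c := i.+1%:R * alpha.
have c0 : 0 < c by rewrite mulr_gt0.
have dm x : 0 < x -> derive1 (fracmono i.+1) x = x `^ (c - 1) / Gamma c.
  by move=> x0; rewrite derive1E; case: (derive_fracmonoS i x0).
have ca : c - alpha = i%:R * alpha by rewrite /c -natr1; ring.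
have abel t : alpha != 1 -> 0 < t ->
  (\int[mu]_(x in `]0%R, t[) ((t - x) `^ (- alpha) * x `^ (c - 1))%:E =
   (Gamma c * Gamma (1 - alpha) * fracmono i t)%:E)%E.
  move=> a1 t0.
  have a10 : 0 < 1 - alpha by rewrite subr_gt0 lt_neqAle a1; case/andP: halpha.
  have := integral_abel c0 a10 t0.
  rewrite (_ : 1 - alpha - 1 = - alpha); last by ring.
  rewrite (_ : c + (1 - alpha) - 1 = i%:R * alpha); last by rewrite -ca; ring.
  rewrite (_ : c + (1 - alpha) = 1 + i%:R * alpha); last by rewrite -ca; ring.
  by move=> ->; congr _%:E; rewrite /fracmono mulrA mulrAC.
have integ t : alpha != 1 -> 0 < t -> mu.-integrable `]0, t[
    (fun x => ((t - x) `^ (- alpha) * x `^ (c - 1))%:E).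
  move=> a1 t0; apply/integrableP; split.
    apply/measurable_EFinP; apply: measurable_funTS; apply: measurable_funM.
      apply: (measurableT_comp (measurable_powR _)).
      exact: measurable_funB.
    exact: measurable_powR.
  under eq_integral => x _ do rewrite gee0_abs ?lee_fin ?mulr_ge0 ?powR_ge0//.
  by rewrite abel// ltry.
split => [t t0|t t0].
  split; first by case: (derive_fracmonoS i t0).
  move=> a1; have := integrableZl _ (Gamma c)^-1 (integ t a1 t0).
  move=> /(_ (measurable_itv _)); apply: eq_integrable => // x.
  rewrite inE/= in_itv/= => /andP[x0 _].
  by rewrite dm// -EFinM; congr _%:E; rewrite mulrC mulrA.
have [a1|a1] := eqVneq alpha 1.
  rewrite (caputo1E _ _ a1) (dm _ t0) /fracmono -ca a1.
  by congr (_ / Gamma _); ring.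
rewrite (caputoE _ _ a1).
have a10 : 0 < 1 - alpha by rewrite subr_gt0 lt_neqAle a1; case/andP: halpha.
transitivity ((Gamma (1 - alpha))^-1 * ((Gamma c)^-1 * \int[mu]_(x in `]0, t[)
   ((t - x) `^ (- alpha) * x `^ (c - 1)))).
  congr (_ * _); rewrite -(RintegralZl _ _ (integ t a1 t0))//.
  apply: eq_Rintegral => x.
  rewrite inE/= in_itv/= => /andP[x0 _].
  by rewrite dm// mulrA [RHS]mulrC.
rewrite /Rintegral abel//=.
rewrite mulrA -invfM (mulrC (Gamma (1 - alpha))) mulKf//.
by rewrite mulf_neq0// gt_eqF// Gamma_gt0.
Qed.

Definition fracsum b n t : R := \sum_(i < n) b i * fracmono i t.

Lemma fracsumS b n : fracsum b n.+1 = fun t => fracsum b n t + b n * fracmono n t.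
Proof. by apply/funext => t; rewrite /fracsum big_ord_recr. Qed.

Lemma caputo_fracsum b n : caputo_exists alpha (fracsum b n) /\
  forall t, 0 < t ->
    caputo alpha (fracsum b n) t = fracsum (fun i => b i.+1) n.-1 t.
Proof.
elim: n => [|n [IH1 IH2]].
  have -> : fracsum b 0 = fun=> 0 by apply/funext => t; rewrite /fracsum big_ord0.
  split; first exact: (caputo_cst 0).1.
  by move=> t _; rewrite (caputo_cst 0).2 /fracsum big_ord0.
have em : caputo_exists alpha (fracmono n).
  case: n {IH1 IH2} => [|n]; last exact: (caputo_fracmonoS n).1.
  by rewrite fracmono0; exact: (caputo_cst 1).1.
rewrite fracsumS; split; first exact/caputo_existsD/caputo_existsZ.
move=> t t0; rewrite caputoD//; last exact: caputo_existsZ.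
rewrite caputoZ// IH2//=; case: n {IH1 IH2 em} => [|n] /=.
  by rewrite fracmono0 (caputo_cst 1).2 mulr0 addr0.
by rewrite fracsumS (caputo_fracmonoS n).2.
Qed.

(** Each derivative loses the constant term and shifts the other coefficients
    down by one. The nonhomogeneous term h is known only through the existence
    of its Caputo derivatives, so its iterates are kept as they are. *)
Lemma caputo_iter_fracsumD b n h :
  (forall j, caputo_exists alpha (caputo_iter alpha j h)) ->
  forall j t, 0 < t -> caputo_iter alpha j (fun t => fracsum b n t + h t) t =
    fracsum (fun i => b (i + j)%N) (n - j) t + caputo_iter alpha j h t.
Proof.
move=> eh; elim=> [|j IH] t t0.
  by rewrite subn0 /=; congr (_ + _); apply: eq_bigr => i _; rewrite addn0.
rewrite /caputo_iter !iterS -!/(caputo_iter _ _ _) (eq_caputo_pos IH)//.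
have [e1 c1] := caputo_fracsum (fun i => b (i + j)%N) (n - j).
rewrite (caputoD e1 (eh j) t0).
rewrite c1// subnS; congr (_ + _); apply: eq_bigr => i _.
by rewrite addSnnS.
Qed.

(** All terms but the constant one carry a positive power of t. *)
Lemma cvg_fracsum b n : (0 < n)%N -> fracsum b n t @[t --> 0^'+] --> b 0%N.
Proof.
case: n => // n _; rewrite -[b 0%N]addr0.
under eq_fun do rewrite /fracsum big_ord_recl/=.
apply: cvgD; first by rewrite fracmono0 mulr1; exact: cvg_cst.
have S0 : \sum_(i < n) (b (lift ord0 i) * (0 / Gamma (1 + (lift ord0 i)%:R * alpha))) = 0.
  by apply: big1 => i _; rewrite mul0r mulr0.
rewrite -[X in _ --> X]S0; apply: cvg_sum_ord => i; apply: cvgM; first exact: cvg_cst.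
apply: cvgM; last exact: cvg_cst.
by apply: powR_cvg0; rewrite mulr_gt0// ltr0n.
Qed.

End CaputoCalculus.

(** * Laplace transforms of fractional powers and of the nonhomogeneous term *)

Section LaplaceTransform.
Context {R : realType}.
Implicit Types (g h : R -> R) (b : nat -> R) (i j n : nat) (s t : R).
Local Notation mu := (@lebesgue_measure R).

(** Absolute convergence at s, without which the transform of a sum need not be
    the sum of the transforms. *)
Definition laplace_integrable g s : Prop :=
  mu.-integrable `[0, +oo[ (fun t => (g t * expR (- (s * t)))%:E).

Lemma laplace_integrableD g1 g2 s :
  laplace_integrable g1 s -> laplace_integrable g2 s ->
  laplace_integrable (fun t => g1 t + g2 t) s.
Proof.
move=> i1 i2; apply: eq_integrable (integrableD _ i1 i2) => // t _.
by rewrite mulrDl EFinD.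
Qed.

Lemma laplaceD g1 g2 s :
  laplace_integrable g1 s -> laplace_integrable g2 s ->
  laplace (fun t => g1 t + g2 t) s = laplace g1 s + laplace g2 s.
Proof.
move=> i1 i2; rewrite /laplace -RintegralD//.
by apply: eq_Rintegral => t _; rewrite mulrDl.
Qed.

Lemma laplace_integrableZ k g s :
  laplace_integrable g s -> laplace_integrable (fun t => k * g t) s.
Proof.
move=> i1; apply: eq_integrable (integrableZl _ k i1) => // t _.
by rewrite -mulrA EFinM.
Qed.

Lemma laplaceZ k g s : laplace_integrable g s ->
  laplace (fun t => k * g t) s = k * laplace g s.
Proof.
move=> i1; rewrite /laplace -RintegralZl//.
by apply: eq_Rintegral => t _; rewrite mulrA.
Qed.

Let measurable_kernel s : measurable_fun setT (fun t : R => expR (- (s * t))).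
Proof.
by apply: measurableT_comp => //; apply: measurableT_comp.
Qed.

Lemma laplace_powR (c s : R) : 0 <= c -> 0 < s ->
  laplace_integrable (@powR R ^~ c) s /\
  laplace (@powR R ^~ c) s = Gamma (1 + c) / s `^ (1 + c).
Proof.
move=> c0 s0; split; last by rewrite /laplace /Rintegral integral_powR_expR.
apply/integrableP; split.
  apply/measurable_EFinP; apply: measurable_funTS; apply: measurable_funM.
    exact: measurable_powR.
  exact: measurable_kernel.
under eq_integral => x _
  do rewrite gee0_abs ?lee_fin ?mulr_ge0 ?expR_ge0 ?powR_ge0//.
by rewrite integral_powR_expR// ltry.
Qed.

Lemma laplace_fracsum (alpha : R) b n s : 0 < alpha -> 0 < s ->
  laplace_integrable (fracsum alpha b n) s /\
  laplace (fracsum alpha b n) s = \sum_(i < n) b i / s `^ (1 + i%:R * alpha).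
Proof.
move=> a0 s0; elim: n => [|n [IH1 IH2]].
  have -> : fracsum alpha b 0 = fun t => 0 * t `^ 0.
    by apply/funext => t; rewrite /fracsum big_ord0 mul0r.
  have [ip _] := laplace_powR (lexx 0) s0.
  by rewrite laplaceZ// big_ord0 mul0r; split => //; exact: laplace_integrableZ.
have n0 : 0 <= n%:R * alpha by rewrite mulr_ge0// ltW.
have [ip lp] := laplace_powR n0 s0.
have -> : fracsum alpha b n.+1 = fun t => fracsum alpha b n t +
    b n / Gamma (1 + n%:R * alpha) * t `^ (n%:R * alpha).
  by rewrite fracsumS; apply/funext => t; rewrite /fracmono mulrAC mulrA.
have ic := laplace_integrableZ (b n / Gamma (1 + n%:R * alpha)) ip.
split; first exact: laplace_integrableD.
rewrite laplaceD// laplaceZ// lp IH2 big_ord_recr/=; congr (_ + _).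
rewrite mulrA mulfVK// gt_eqF//.
by rewrite Gamma_gt0// ltr_wpDr.
Qed.

(** Exponential order controls h near infinity and the limit at 0+ controls it
    near 0; on the compact interval in between continuity does. *)
Lemma exp_bounded h : {in `]0, +oo[, continuous h} -> cvg (h t @[t --> 0^'+]) ->
  exponential_order h ->
  exists K a : R, [/\ 0 <= K, 0 <= a & forall t, 0 <= t -> `|h t| <= K * expR (a * t)].
Proof.
move=> ch /cvg_ex[l hl] [C [a [T [_ CT]]]].
have [d /= d0 dl] : \forall t \near 0^'+, `|h t| < `|l| + 1.
  by apply: (cvgr_norm_lt _ hl); rewrite ltrDl.
pose T1 := Num.max d (T + 1).
have dT : d / 2 <= T1.
  by rewrite le_max; apply/orP; left; lra.
have cI : {within `[d / 2, T1], continuous h}.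
  apply: continuous_in_subspaceT => x; rewrite inE/= in_itv/= => /andP[dx _].
  by apply: ch; rewrite in_itv/= andbT (lt_le_trans _ dx)// divr_gt0.
have [c1 _ h1] := EVT_max dT cI.
have [c2 _ h2] := EVT_min dT cI.
have C0 := normr_ge0 C; have l0 := normr_ge0 l; have n0 := normr_ge0 (h 0).
have n1 := normr_ge0 (h c1); have n2 := normr_ge0 (h c2).
pose K := `|C| + (`|l| + 1) + (`|h c1| + `|h c2|) + `|h 0|.
have K0 : 0 <= K by rewrite /K; lra.
(* Each of the bounds used below is one of the summands of K; the summand
   at h 0 covers the end point t = 0, where h need not be continuous. *)
exists K, `|a|; split => // t t0.
have e1 : 1 <= expR (`|a| * t) by rewrite -[leLHS]expR0 ler_expR mulr_ge0.
have bnd B : `|h t| <= B -> B <= K -> `|h t| <= K * expR (`|a| * t).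
  by move=> tB BK; rewrite (le_trans tB)// (le_trans BK)// ler_peMr.
have [t00|tn0] := eqVneq t 0.
  by apply: (bnd `|h 0|); rewrite ?t00// /K; lra.
have tp : 0 < t by rewrite lt_neqAle eq_sym tn0.
have [td|td] := ltP t d.
  have := dl t; rewrite /= sub0r normrN gtr0_norm// => /(_ td tp)/ltW tb.
  by apply: (bnd _ tb); rewrite /K; lra.
have [tT|tT] := ltP T1 t.
  have : T < t by rewrite (le_lt_trans _ tT)// le_max; apply/orP; right; lra.
  move=> /CT/= hC; rewrite (le_trans hC)// (le_trans (ler_norm _))//.
  rewrite normrM (ger0_norm (expR_ge0 _)) ler_pM ?expR_ge0//; first by rewrite /K; lra.
  by rewrite ler_expR ler_wpM2r// ler_norm.
have tI : t \in `[d / 2, T1] by rewrite in_itv/= tT andbT; lra.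
apply: (bnd (`|h c1| + `|h c2|)); last by rewrite /K; lra.
have := h1 _ tI; have := h2 _ tI; rewrite ler_norml.
have := ler_norm (h c1); have := ler_norm (- h c2); rewrite normrN; lra.
Qed.

(** By [exp_bounded] the integrand is dominated by K exp(-(s - a) t) when
    s > a. *)
Lemma laplace_integrable_exp h : {in `]0, +oo[, continuous h} ->
  cvg (h t @[t --> 0^'+]) -> exponential_order h ->
  \forall s \near +oo, laplace_integrable h s.
Proof.
move=> ch ch0 eh; have [K [a [K0 a0 Kh]]] := exp_bounded ch ch0 eh.
near=> s.
have sa : 0 < s - a.
  by rewrite subr_gt0; near: s; apply: nbhs_pinfty_gt; exact: num_real.
have [ip _] := laplace_powR (lexx 0) sa.
apply: (@le_integrable _ _ _ mu _ (measurable_itv _) _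
    (fun t => (K * (t `^ 0 * expR (- ((s - a) * t))))%:E)); last first.
- by apply: eq_integrable (integrableZl _ K ip).
- move=> t; rewrite /= in_itv/= andbT => t0.
  rewrite lee_fin normrM (ger0_norm (expR_ge0 _)).
  rewrite [leRHS]ger0_norm ?mulr_ge0 ?powR_ge0 ?expR_ge0//.
  rewrite powRr0 mul1r (_ : - ((s - a) * t) = a * t + - (s * t)); last by ring.
  by rewrite expRD mulrA ler_wpM2r ?expR_ge0// Kh.
apply/measurable_EFinP; apply: measurable_funM; last first.
  by apply: measurable_funTS; exact: measurable_kernel.
apply/measurable_fun_itv_obnd_cbndP.
apply: open_continuous_measurable_fun => // t.
by rewrite inE => /ch.
Unshelve. all: by end_near. Qed.

End LaplaceTransform.

(** * The operator on truncated series *)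

Section SpaceDerivatives.
Context {R : realType} (I : interval R).
Hypothesis hI : exists a b : R, [/\ a \in I, b \in I & a < b].
Implicit Types (f g : R -> R) (x y : R) (q N n : nat).

(** Because I is an interval with more than one point, x is a limit of other
    points of I; hence the limits defining the derivatives are unique. *)
Lemma proper_diff_quot x : x \in I ->
  ProperFilter (within [set h | h + x \in I] (0 : R)^').
Proof.
have [a [b [aI bI ab]]] := hI; move=> xI.
have conv u v w : u \in I -> v \in I -> u <= w <= v -> w \in I.
  by move=> uI vI; apply: (@interval_is_interval _ I u v uI vI).
apply: Build_ProperFilter_ex => A [e /= e0 eA].
suff [d [d0 de dI]] : exists d, [/\ d != 0, `|d| < e & d + x \in I].
  by exists d; apply: eA => //=; rewrite sub0r normrN.
have [xb|bx] := ltP x b.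
  exists (Num.min (e / 2) (b - x)); have d0 : 0 < Num.min (e / 2) (b - x).
    by rewrite lt_min divr_gt0//= subr_gt0.
  split; first by rewrite gt_eqF.
    by rewrite gtr0_norm// gt_min; apply/orP; left; lra.
  apply: (conv x b) => //; apply/andP; split; first by lra.
  by rewrite -lerBrDr ge_min lexx orbT.
exists (- Num.min (e / 2) (x - a)).
have d0 : 0 < Num.min (e / 2) (x - a).
  by rewrite lt_min divr_gt0//= subr_gt0 (lt_le_trans ab).
split; first by rewrite oppr_eq0 gt_eqF.
  by rewrite normrN gtr0_norm// gt_min; apply/orP; left; lra.
apply: (conv a x) => //; apply/andP; split; last by lra.
by rewrite addrC lerBrDl -lerBrDr ge_min lexx orbT.
Qed.

Lemma eq_diff_quot f g x : {in I, f =1 g} -> x \in I ->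
  diff_quot I f x = diff_quot I g x.
Proof.
move=> fg xI; apply/funext => A; apply/propext; split;
  apply: (@filterS _ (0 : R)^') => h /= hA hxI; have := hA hxI;
  by rewrite !fg.
Qed.

(** The difference quotients only look at points of I, so derivatives on I can
    be iterated through equalities that hold on I. *)
Lemma eq_Dx q f g : {in I, f =1 g} -> {in I, Dx I q f =1 Dx I q g}.
Proof.
move=> fg; elim: q => [|q IH] x xI; first exact: fg.
by rewrite /Dx !iterS /Dx1 (eq_diff_quot IH).
Qed.

Lemma Dx_sum N n (phi : nat -> R -> R) (w : nat -> R) :
  (forall i, differentiable_upto I N (phi i)) ->
  forall q, (q <= N)%N -> {in I, Dx I q (fun y => \sum_(i < n) phi i y * w i) =1
    (fun y => \sum_(i < n) Dx I q (phi i) y * w i)}.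
Proof.
move=> hphi; elim=> [//|q IH] qN x xI.
rewrite /Dx iterS -/(Dx _ _ _) /Dx1 (eq_diff_quot (IH (ltnW qN)) xI).
have pF := proper_diff_quot xI.
apply/cvg_lim => //; rewrite /diff_quot.
under eq_fun => h.
  rewrite -sumrB scaler_sumr.
  under eq_bigr do rewrite -mulrBl scalerAl.
  over.
apply: cvg_sum_ord => i; apply: cvgM; last exact: cvg_cst.
exact: (hphi i q x qN xI).
Qed.

End SpaceDerivatives.

Section TruncatedOperator.
Context {R : realType} (I : interval R).
Hypothesis hI : exists a b : R, [/\ a \in I, b \in I & a < b].
Variables (alpha : R) (M N : nat) (c : nat -> R -> R) (h : R -> R -> R).
Variable phi : nat -> R -> R.
Hypothesis hphi : forall n, differentiable_upto I N (phi n).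
Implicit Types (x y t : R) (i j k K n : nat).

Let powR_natM i t : t `^ (i%:R * alpha) = (t `^ alpha) ^+ i.
Proof. by rewrite mulrC powRrM powR_mulrn ?powR_ge0. Qed.

(** The truncated series as a polynomial in t^alpha. *)
Let scaled (a : nat -> R) K : {poly R} :=
  \poly_(i < K) (a i / Gamma (1 + i%:R * alpha)).

Let scaledE a K t : (scaled a K).[t `^ alpha] =
  \sum_(i < K) a i * (t `^ (i%:R * alpha) / Gamma (1 + i%:R * alpha)).
Proof.
rewrite horner_poly; apply: eq_bigr => i _.
by rewrite powR_natM mulrAC mulrA.
Qed.

(** The polynomial in t^alpha that the homogeneous part of the operator produces
    from the first K terms of the series, at the point x. *)
Definition Rop_poly K x : {poly R} :=
  \sum_(1 <= p < M.+1) \sum_(0 <= q < N.+1)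
    (c p x)%:P * scaled (phi^~ x) K ^+ p * scaled (fun i => Dx I q (phi i) x) K.

Lemma Rop_polyE K psi x :
  (forall y t, y \in I -> psi y t =
     \sum_(i < K) phi i y * t `^ (i%:R * alpha) / Gamma (1 + i%:R * alpha)) ->
  x \in I ->
  Rop I M N c h psi x = fun t => (Rop_poly K x).[t `^ alpha] + h x t.
Proof.
move=> psiE xI; apply/funext => t; rewrite /Rop /Rop_poly; congr (_ + _).
rewrite horner_sum; apply: eq_bigr => p _.
rewrite horner_sum big_seq [RHS]big_seq; apply: eq_bigr => q.
rewrite mem_index_iota ltnS => /= qN.
rewrite !hornerM horner_exp hornerC !scaledE psiE//.
congr (_ * _ * _).
  by congr (_ ^+ _); apply: eq_bigr => i _; rewrite mulrA.
have := @eq_Dx _ _ q _ _ (fun y yI => psiE y t yI) x xI => ->.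
under eq_fun do under eq_bigr do rewrite -mulrA.
exact: (Dx_sum hI K (fun i => t `^ (i%:R * alpha) / Gamma (1 + i%:R * alpha)) hphi qN xI).
Qed.

Let coefM_low (p1 p2 q1 q2 : {poly R}) j :
  (forall i, (i <= j)%N -> p1`_i = p2`_i) ->
  (forall i, (i <= j)%N -> q1`_i = q2`_i) ->
  forall i, (i <= j)%N -> (p1 * q1)`_i = (p2 * q2)`_i.
Proof.
move=> hp hq i ij; rewrite !coefM; apply: eq_bigr => k _.
have ki : (k <= i)%N by rewrite -ltnS.
by rewrite hp ?(leq_trans ki)// hq// (leq_trans (leq_subr _ _)).
Qed.

(** Raising the truncation order changes the factors only in degrees above j,
    hence also their products. *)
Lemma coef_Rop_poly j K K' x : (j < K)%N -> (j < K')%N ->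
  (Rop_poly K x)`_j = (Rop_poly K' x)`_j.
Proof.
move=> jK jK'.
have low a i : (i <= j)%N -> (scaled a K)`_i = (scaled a K')`_i.
  by move=> ij; rewrite !coef_poly !(leq_ltn_trans ij).
rewrite !coef_sum; apply: eq_bigr => p _; rewrite !coef_sum; apply: eq_bigr => q _.
apply: (coefM_low (j := j)) => // i ij; last exact: low.
apply: (coefM_low (j := j)) => // {i ij}.
elim: p => [|p IH] i ij; first by rewrite !expr0.
by rewrite !exprS; apply: (coefM_low (j := j)) => // k; exact: low.
Qed.

(** The coefficients in the basis [fracmono]. *)
Definition Rop_coef K x i : R := (Rop_poly K x)`_i * Gamma (1 + i%:R * alpha).

Lemma horner_fracsum K x n t : 0 <= alpha -> (size (Rop_poly K x) <= n)%N ->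
  (Rop_poly K x).[t `^ alpha] = fracsum alpha (Rop_coef K x) n t.
Proof.
move=> a0 sn; rewrite (horner_coef_wide _ sn); apply: eq_bigr => i _.
rewrite /Rop_coef /fracmono powR_natM mulrA mulrAC mulfK//.
by rewrite gt_eqF// Gamma_gt0// ltr_wpDr// mulr_ge0.
Qed.

End TruncatedOperator.

(** * The coefficients of the residual power series *)

Lemma cvg_powRN_pinfty {R : realType} (c : R) : 0 < c ->
  s `^ (- c) @[s --> +oo] --> (0 : R).
Proof.
move=> c0; apply/cvgr0Pnorm_lt => e e0; near=> s.
have s0 : 0 < s by near: s; apply: nbhs_pinfty_gt; exact: num_real.
rewrite gtr0_norm ?powR_gt0// powRN invf_plt ?posrE ?powR_gt0//.
have -> : e^-1 = (e^-1 `^ c^-1) `^ c.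
  by rewrite -powRrM mulVf ?gt_eqF// powRr1// invr_ge0 ltW.
by apply: gt0_ltr_powR; rewrite ?nnegrE ?powR_ge0 ?(ltW s0).
Unshelve. all: by end_near. Qed.

(** Here P i stands for phi_(m+i), B i and H i for the coefficients of the
    polynomial part and of the nonhomogeneous term, and w i for the power
    s^((j - i) alpha); L is s L(D^(j alpha) h)(s). The indices below j cancel,
    leaving the constant term, the indices above j, and L. *)
Lemma residual_split {R : comNzRingType} (P B H w : nat -> R) (L : R) (j r : nat) :
  (forall i, (i < j)%N -> P i = B i + H i) ->
  \sum_(i < j.+1) P i * w i - \sum_(i < j.+1 + r) B i * w i
    - (L + \sum_(i < j) H i * w i) =
  (P j - B j) * w j - \sum_(i < r) B (j.+1 + i)%N * w (j.+1 + i)%N - L.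
Proof.
move=> PBH; rewrite big_split_ord !big_ord_recr/=.
have -> : \sum_(i < j) P i * w i =
    \sum_(i < j) B i * w i + \sum_(i < j) H i * w i.
  rewrite -big_split/=; apply: eq_bigr => i _.
  by rewrite -mulrDl (PBH i (ltn_ord i)).
by ring.
Qed.

Section ResidualCoefficients.
Context {R : realType} (I : interval R).
Hypothesis hI : exists a b : R, [/\ a \in I, b \in I & a < b].
Variables (alpha : R) (m M N : nat) (c : nat -> R -> R) (h : R -> R -> R).
Variables f phi : nat -> R -> R.
Hypothesis halpha : 0 < alpha <= 1.
Hypothesis hphi : forall n, differentiable_upto I N (phi n).
Hypothesis hh : forall x, x \in I -> laplace_admissible alpha (h x).
Hypothesis hLRPS : LRPS_coefficients I alpha m M N c h f phi.
Implicit Types (x t s : R) (i j k n : nat).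

Let alpha0 : 0 < alpha. Proof. by case/andP: halpha. Qed.

Local Notation Rcoef := (Rop_coef I alpha M N c phi).
Local Notation Rpoly := (Rop_poly I alpha M N c phi).
Local Notation h0 x j := (initial_value (caputo_iter alpha j (h x))).

Lemma cvg_initial_value x j : x \in I ->
  caputo_iter alpha j (h x) t @[t --> 0^'+] --> h0 x j.
Proof. by move=> xI; have [/(_ j)[_ [/(_ 0 (lexx _)) + _ _] _ _] _] := hh xI. Qed.

(** The Caputo derivatives of h exist by assumption, so h is differentiable and
    in particular continuous on t > 0. *)
Lemma laplace_integrable_h x : x \in I ->
  \forall s \near +oo, laplace_integrable (h x) s.
Proof.
move=> xI; have [/(_ 0%N)[ce pc eo _] _] := hh xI.
apply: laplace_integrable_exp => //; last by case: pc => /(_ 0 (lexx _)).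
move=> t; rewrite in_itv/= andbT => t0.
by apply/differentiable_continuous/derivable1_diffP; case: (ce t t0).
Qed.

Lemma psi_truncE k y t : (m <= k)%N -> y \in I -> psi_trunc alpha m f phi k y t =
  \sum_(i < k.+1) phi i y * t `^ (i%:R * alpha) / Gamma (1 + i%:R * alpha).
Proof.
move=> mk yI; rewrite -[RHS](big_mkord xpredT
  (fun i => phi i y * t `^ (i%:R * alpha) / Gamma (1 + i%:R * alpha))).
rewrite (@big_cat_nat _ _ _ m)//=; last exact: leqW.
congr (_ + _); rewrite big_seq [RHS]big_seq; apply: eq_bigr => i.
by rewrite mem_index_iota => /= im; rewrite (hLRPS.1 i y im yI).
Qed.

(** The scaled residual for k = m + j as an explicit combination of powers of s.
    The bound n may exceed the size of the polynomial, which lets the sum be cut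
    at j in [LRPS_coefficientE]. *)
Lemma laplace_residual x j n : x \in I ->
  (size (Rpoly (m + j).+1 x) <= n)%N ->
  \forall s \near +oo,
  s `^ ((m + j)%:R * alpha + 1) * LRes I alpha m M N c h f phi (m + j) x s =
  \sum_(i < j.+1) phi (m + i)%N x * s `^ ((j%:R - i%:R) * alpha)
  - \sum_(i < n) Rcoef (m + j).+1 x i * s `^ ((j%:R - i%:R) * alpha)
  - (s * laplace (caputo_iter alpha j (h x)) s
     + \sum_(i < j) h0 x i * s `^ ((j%:R - i%:R) * alpha)).
Proof.
move=> xI sn; near=> s.
have s0 : 0 < s by near: s; apply: nbhs_pinfty_gt; exact: num_real.
have ih : laplace_integrable (h x) s by near: s; exact: laplace_integrable_h.
have rule : laplace (caputo_iter alpha j (h x)) s =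
   s `^ (j%:R * alpha) * laplace (h x) s
   - \sum_(0 <= i < j) s `^ ((j - i)%N%:R * alpha - 1) * h0 x i.
  by near: s; exact: (hh xI).2.
have pD u v : s `^ u * s `^ v = s `^ (u + v).
  by rewrite powRD// (gt_eqF s0) implybT.
have [il ll] := laplace_fracsum (Rcoef (m + j).+1 x) n alpha0 s0.
rewrite /LRes.
have -> : Rop I M N c h (psi_trunc alpha m f phi (m + j)) x =
    fun t => fracsum alpha (Rcoef (m + j).+1 x) n t + h x t.
  rewrite (@Rop_polyE _ _ hI alpha M N c h phi hphi (m + j).+1)//.
    by apply/funext => t; rewrite (horner_fracsum t (ltW alpha0) sn).
  by move=> y t yI; rewrite psi_truncE// leq_addr.
rewrite laplaceD// ll /Psi_trunc [X in X - _ - _]addrC addrK.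
have -> : \sum_(m <= i < (m + j).+1) phi i x / s `^ (1 + i%:R * alpha) =
    \sum_(i < j.+1) phi (m + i)%N x / s `^ (1 + (m + i)%:R * alpha).
  rewrite -{1}[m]add0n -addnS big_addn addKn big_mkord.
  by apply: eq_bigr => i _; rewrite addnC.
rewrite mulrBr mulr_sumr -addrA; congr (_ + _).
  apply: eq_bigr => i _; rewrite mulrCA -powRN pD; congr (_ * _ `^ _).
  by rewrite !natrD; ring.
rewrite -opprD; congr (- _).
rewrite mulrA -powRN pD mulrDr mulr_sumr; congr (_ + _).
  apply: eq_bigr => i _; rewrite mulrCA -powRN pD; congr (_ * _ `^ _).
  by rewrite !natrD; ring.
have ss u : s * s `^ u = s `^ (1 + u).
  by rewrite -{1}(powRr1 (ltW s0)) pD.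
have -> : (m + j)%:R * alpha + 1 + - (m%:R * alpha) = 1 + j%:R * alpha.
  by rewrite natrD; ring.
rewrite rule mulrBr mulrA ss mulr_sumr big_mkord -addrA.
rewrite -[LHS]addr0; congr (_ + _); rewrite addrC.
apply/esym/eqP; rewrite subr_eq0; apply/eqP; apply: eq_bigr => i _.
rewrite [RHS]mulrA ss [RHS]mulrC; congr (_ * _ `^ _).
by rewrite natrB ?(ltnW (ltn_ord i))//; ring.
Unshelve. all: by end_near. Qed.

(** The induction hypothesis removes from the scaled residual the powers of s
    that grow; what remains converges, and its limit must be 0. *)
Lemma LRPS_coefficientE j x : x \in I ->
  phi (m + j)%N x = Rcoef j.+1 x j + h0 x j.
Proof.
move=> xI; elim/ltn_ind: j => j IH.
pose K := (m + j).+1; pose r := size (Rpoly K x).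
have low i : (i <= j)%N -> Rcoef K x i = Rcoef i.+1 x i.
  move=> ij; rewrite /Rop_coef (@coef_Rop_poly _ _ _ _ _ _ _ i K i.+1)//.
  by rewrite ltnS (leq_trans ij)// leq_addl.
have sn : (size (Rpoly (m + j).+1 x) <= j.+1 + r)%N by rewrite leq_addl.
have res := laplace_residual xI sn.
have lim0 := hLRPS.2 (m + j)%N x (leq_addr _ _) xI.
have lim1 : s `^ ((m + j)%:R * alpha + 1) * LRes I alpha m M N c h f phi (m + j) x s
    @[s --> +oo] --> phi (m + j)%N x - Rcoef j.+1 x j - h0 x j.
  have tail : \sum_(i < r) Rcoef K x (j.+1 + i)%N * s `^ (- (i.+1%:R * alpha))
      @[s --> +oo] --> (0 : R).
    rewrite -[X in _ --> X](_ : \sum_(i < r) Rcoef K x (j.+1 + i)%N * 0 = 0); last first.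
      by rewrite big1// => i _; rewrite mulr0.
    apply: cvg_sum_ord => i; apply: cvgM; first exact: cvg_cst.
    by apply: cvg_powRN_pinfty; rewrite mulr_gt0.
  have main : phi (m + j)%N x - Rcoef j.+1 x j
      - \sum_(i < r) Rcoef K x (j.+1 + i)%N * s `^ (- (i.+1%:R * alpha))
      - s * laplace (caputo_iter alpha j (h x)) s @[s --> +oo] -->
      phi (m + j)%N x - Rcoef j.+1 x j - 0 - h0 x j.
    apply: cvgB; first by apply: cvgB => //; exact: cvg_cst.
    by have [/(_ j)[_ _ _ +] _] := hh xI.
  rewrite subr0 in main; apply: cvg_trans main; apply: near_eq_cvg.
  near=> s; rewrite (near res s)//.
  rewrite (@residual_split _ (fun i => phi (m + i)%N x) (Rcoef K x)
             (fun i => h0 x i) (fun i => s `^ ((j%:R - i%:R) * alpha))).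
    rewrite (low _ (leqnn j)) subrr mul0r powRr0 mulr1; congr (_ - _ - _).
    apply: eq_bigr => i _; congr (_ * _ `^ _).
    by rewrite natrD -!natr1; ring.
  by move=> i ij; rewrite (IH i ij) (low _ (ltnW ij)).
have /eqP : phi (m + j)%N x - Rcoef j.+1 x j - h0 x j = 0.
  exact: (cvg_unique _ lim1 lim0).
by rewrite -addrA -opprD subr_eq0 => /eqP.
Unshelve. all: by end_near. Qed.

(** After j Caputo derivatives the constant term is the j-th coefficient, and
    [LRPS_coefficientE] identifies it, together with the initial value of
    D^(j alpha) h, with phi_(m+j). *)
Lemma cvg_caputo_iter_Rop j x psi : x \in I ->
  (forall y t, y \in I -> psi y t =
     \sum_(i < j.+1) phi i y * t `^ (i%:R * alpha) / Gamma (1 + i%:R * alpha)) ->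
  caputo_iter alpha j (Rop I M N c h psi x) t @[t --> 0^'+] --> phi (m + j)%N x.
Proof.
move=> xI psiE; rewrite LRPS_coefficientE//.
pose n := (j.+1 + size (Rpoly j.+1 x))%N.
have -> : Rop I M N c h psi x =
    fun t => fracsum alpha (fun i => Rcoef j.+1 x i) n t + h x t.
  rewrite (@Rop_polyE _ _ hI alpha M N c h phi hphi j.+1)//.
  by apply/funext => t; rewrite (horner_fracsum (n := n) t (ltW alpha0))// leq_addl.
have ce k : caputo_exists alpha (caputo_iter alpha k (h x)).
  by have [/(_ k)[]] := hh xI.
have nj : (0 < n - j)%N by rewrite subn_gt0 /n addSn ltnS leq_addr.
have lim1 : fracsum alpha (fun i => Rcoef j.+1 x (i + j)%N) (n - j) t +
    caputo_iter alpha j (h x) t @[t --> 0^'+] --> Rcoef j.+1 x j + h0 x j.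
  by apply: cvgD; [exact: cvg_fracsum|exact: cvg_initial_value].
apply: cvg_trans lim1; apply: near_eq_cvg; near=> t.
rewrite (caputo_iter_fracsumD halpha _ _ ce)//.
Unshelve. all: by end_near. Qed.

End ResidualCoefficients.

Theorem mainTheorem2 (R : realType) (I : interval R) (alpha : R) (m M N : nat)
    (c : nat -> R -> R) (h : R -> R -> R) (f phi : nat -> R -> R)
    (hI : exists a b : R, [/\ a \in I, b \in I & a < b])
    (halpha : 0 < alpha <= 1) (hm : (0 < m)%N) (hM : (1 <= M)%N)
    (hphi : forall n, differentiable_upto I N (phi n))
    (hh : forall x, x \in I -> laplace_admissible alpha (h x))
    (hLRPS : LRPS_coefficients I alpha m M N c h f phi) :
  forall x, x \in I ->
  [/\ Rop I M N c h (fun y _ => f 0%N y) x t @[t --> 0^'+] --> phi m x,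
      caputo alpha
        (Rop I M N c h
           (fun y t => f 0%N y + phi 1%N y * t `^ alpha / Gamma (1 + alpha)) x) t
        @[t --> 0^'+] --> phi m.+1 x
    & forall k, (m + 2 <= k)%N ->
      caputo_iter alpha (k - m)
        (Rop I M N c h
           (fun y t => \sum_(0 <= n < (k - m).+1)
              phi n y * t `^ (n%:R * alpha) / Gamma (1 + n%:R * alpha)) x) t
        @[t --> 0^'+] --> phi k x].
Proof.
have hk := cvg_caputo_iter_Rop hI halpha hphi hh hLRPS.
have f0 y : y \in I -> f 0%N y = phi 0%N y.
  by move=> yI; rewrite (hLRPS.1 0%N y hm yI).
have e0 t : t `^ (0%:R * alpha) / Gamma (1 + 0%:R * alpha) = 1.
  by rewrite mul0r powRr0 addr0 Gamma1 divr1.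
move=> x xI; split.
- rewrite -[m in phi m]addn0; apply: (hk 0%N) => // y t yI.
  by rewrite big_ord1/= -mulrA e0 mulr1 f0.
- rewrite -[m.+1]addn1; apply: (hk 1%N) => // y t yI.
  by rewrite big_ord_recr big_ord1/= -[in RHS]mulrA e0 mulr1 (f0 _ yI) mul1r.
- move=> k mk; have km : (m <= k)%N by rewrite (leq_trans _ mk)// leq_addr.
  rewrite -[X in phi X](subnKC km); apply: hk => // y t yI.
  by rewrite big_mkord.
Qed.
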